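(* Let $A$ and $B$ be rings. Then the direct product ring $A\times B$ is perinormal if and only if $A$ and $B$ are both perinormal.
   Context: All rings are commutative with unity. For a ring $A$, $\mathrm{Reg}(A)$ is the set of regular elements (non-zero-divisors) of $A$, and the total quotient ring $K$ of $A$ is the fraction ring of $A$ with denominators in $\mathrm{Reg}(A)$. An overring of $A$ is a ring $B$ with $A\subseteq B\subseteq K$. A ring extension $A\subseteq B$ satisfies going down if, whenever $P_1\subseteq P_2$ are prime ideals of $A$ and $Q_2$ is a prime ideal of $B$ with $Q_2\cap A=P_2$, there is a prime ideal $Q_1\subseteq Q_2$ of $B$ with $Q_1\cap A=P_1$. A GD-overring of $A$ is an overring $B$ of $A$ such that $A\subseteq B$ satisfies going down. A ring $A$ is perinormal if every GD-overring of $A$ is flat as an $A$-module. *)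

(* Defs.v *)
(* Rings are [comPzRingType]s: commutative with unity, the zero ring included.
   Ideals and subrings of the mathematics need not be decidable; boolean
   predicates are obtained from propositions by [asbool]. *)
From HB Require Import structures.
From mathcomp Require Import all_boot all_algebra ring.
From mathcomp Require Import generic_quotient boolp classical_sets.
From mathcomp.multinomials Require Import freeg.

Set Implicit Arguments.
Unset Strict Implicit.
Unset Printing Implicit Defensive.

Import GRing.Theory.
Local Open Scope ring_scope.
Local Open Scope quotient_scope.
Local Open Scope classical_set_scope.

(** * Total quotient ring *)

Section TotalQuotientRing.
Variable A : comPzRingType.

Definition regular (s : A) : Prop := forall x, s * x = 0 -> x = 0.

Lemma regular1 : regular 1. Proof. by move=> x; rewrite mul1r. Qed.

Lemma regularM s t : regular s -> regular t -> regular (s * t).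
Proof. by move=> rs rt x; rewrite -mulrA => /rs/rt. Qed.

Lemma regularI s x y : regular s -> s * x = s * y -> x = y.
Proof.
by move=> rs /eqP; rewrite -subr_eq0 -mulrBr => /eqP/rs/eqP;
  rewrite subr_eq0 => /eqP.
Qed.

Record ratio := Ratio { ratio_val :> A * A; _ : `[< regular ratio_val.2 >] }.
HB.instance Definition _ := [isSub for ratio_val].
HB.instance Definition _ := [Choice of ratio by <:].

Lemma den_regular (x : ratio) : regular x.2.
Proof. by case: x => x /= /asboolP. Qed.

Definition mk_ratio a s (rs : regular s) : ratio := @Ratio (a, s) (asboolT rs).

(* As denominators are regular, a/s = b/t amounts to a t = b s. *)
Definition ratio_eq (x y : ratio) : bool := x.1 * y.2 == y.1 * x.2.

Lemma ratio_eq_refl : reflexive ratio_eq.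
Proof. by move=> x; apply/eqP. Qed.

Lemma ratio_eq_sym : symmetric ratio_eq.
Proof. by move=> x y; rewrite /ratio_eq eq_sym. Qed.

Lemma ratio_eq_trans : transitive ratio_eq.
Proof.
move=> y x z /eqP xy /eqP yz; apply/eqP; apply: (regularI (@den_regular y)).
transitivity (x.1 * y.2 * z.2); first by ring.
by rewrite xy -[RHS]mulrCA mulrA -yz; ring.
Qed.

Canonical ratio_equiv :=
  EquivRel ratio_eq ratio_eq_refl ratio_eq_sym ratio_eq_trans.

Definition total_quotient := {eq_quot ratio_eq}.
Local Notation K := total_quotient.
HB.instance Definition _ : EqQuotient _ ratio_eq K := EqQuotient.on K.
HB.instance Definition _ := Choice.on K.

Definition frac a s (rs : regular s) : K := \pi_K (mk_ratio a rs).

Lemma frac_eq a s (rs : regular s) b t (rt : regular t) :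
  a * t = b * s <-> frac a rs = frac b rt.
Proof.
by split=> [h|/eqmodP/eqP//]; apply/eqmodP/eqP.
Qed.

Lemma fracP (x : K) : exists a s (rs : regular s), x = frac a rs.
Proof.
elim/quotW: x => -[[a s] h]; exists a, s, (asboolW h).
by congr (\pi_K _); apply: val_inj.
Qed.

Definition ratio_add (x y : ratio) : ratio :=
  mk_ratio (x.1 * y.2 + y.1 * x.2) (regularM (@den_regular x) (@den_regular y)).
Definition ratio_opp (x : ratio) : ratio := mk_ratio (- x.1) (@den_regular x).
Definition ratio_mul (x y : ratio) : ratio :=
  mk_ratio (x.1 * y.1) (regularM (@den_regular x) (@den_regular y)).

Definition tq_add (x y : K) : K := \pi_K (ratio_add (repr x) (repr y)).
Definition tq_opp (x : K) : K := \pi_K (ratio_opp (repr x)).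
Definition tq_mul (x y : K) : K := \pi_K (ratio_mul (repr x) (repr y)).

Lemma frac_repr (x : K) : x = frac (repr x).1 (@den_regular (repr x)).
Proof.
rewrite -[LHS]reprK; case: (repr x) => -[a s] h.
by congr (\pi_K _); apply: val_inj.
Qed.

Lemma tq_addE a s (rs : regular s) b t (rt : regular t) :
  tq_add (frac a rs) (frac b rt) = frac (a * t + b * s) (regularM rs rt).
Proof.
have /frac_eq /= ex := frac_repr (frac a rs).
have /frac_eq /= ey := frac_repr (frac b rt).
apply/esym/frac_eq => /=; move: ex ey.
set x := ratio_val _; set y := ratio_val _ => ex ey.
transitivity (a * x.2 * (t * y.2) + b * y.2 * (s * x.2)); first by ring.
by rewrite ex ey; ring.
Qed.

Lemma tq_oppE a s (rs : regular s) : tq_opp (frac a rs) = frac (- a) rs.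
Proof.
have /frac_eq /= h := frac_repr (frac a rs).
by apply/frac_eq; rewrite /= !mulNr h.
Qed.

Lemma tq_mulE a s (rs : regular s) b t (rt : regular t) :
  tq_mul (frac a rs) (frac b rt) = frac (a * b) (regularM rs rt).
Proof.
have /frac_eq /= ex := frac_repr (frac a rs).
have /frac_eq /= ey := frac_repr (frac b rt).
by apply/esym/frac_eq; rewrite /= mulrACA ex ey mulrACA.
Qed.

Definition tq_embed (a : A) : K := frac a regular1.

Lemma tq_addA : associative tq_add.
Proof.
move=> x y z; have [a [s [rs ->]]] := fracP x; have [b [t [rt ->]]] := fracP y.
have [c [u [ru ->]]] := fracP z.
by rewrite !tq_addE; apply/frac_eq; ring.
Qed.

Lemma tq_addC : commutative tq_add.
Proof.
move=> x y; have [a [s [rs ->]]] := fracP x; have [b [t [rt ->]]] := fracP y.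
by rewrite !tq_addE; apply/frac_eq; ring.
Qed.

Lemma tq_add0 : left_id (tq_embed 0) tq_add.
Proof.
move=> x; have [a [s [rs ->]]] := fracP x; rewrite tq_addE.
by apply/frac_eq; ring.
Qed.

Lemma tq_addN : left_inverse (tq_embed 0) tq_opp tq_add.
Proof.
move=> x; have [a [s [rs ->]]] := fracP x; rewrite tq_oppE tq_addE.
by apply/frac_eq; ring.
Qed.

Lemma tq_mulA : associative tq_mul.
Proof.
move=> x y z; have [a [s [rs ->]]] := fracP x; have [b [t [rt ->]]] := fracP y.
have [c [u [ru ->]]] := fracP z.
by rewrite !tq_mulE; apply/frac_eq; ring.
Qed.

Lemma tq_mulC : commutative tq_mul.
Proof.
move=> x y; have [a [s [rs ->]]] := fracP x; have [b [t [rt ->]]] := fracP y.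
by rewrite !tq_mulE; apply/frac_eq; ring.
Qed.

Lemma tq_mul1 : left_id (tq_embed 1) tq_mul.
Proof.
move=> x; have [a [s [rs ->]]] := fracP x; rewrite tq_mulE.
by apply/frac_eq; ring.
Qed.

Lemma tq_mulDl : left_distributive tq_mul tq_add.
Proof.
move=> x y z; have [a [s [rs ->]]] := fracP x; have [b [t [rt ->]]] := fracP y.
have [c [u [ru ->]]] := fracP z.
by rewrite !(tq_addE, tq_mulE); apply/frac_eq; ring.
Qed.

HB.instance Definition _ :=
  GRing.isZmodule.Build K tq_addA tq_addC tq_add0 tq_addN.
HB.instance Definition _ :=
  GRing.Zmodule_isComPzRing.Build K tq_mulA tq_mulC tq_mul1 tq_mulDl.

Lemma tq_embed_is_zmod_morphism : zmod_morphism tq_embed.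
Proof.
move=> a b; rewrite [- tq_embed b]tq_oppE [RHS]tq_addE.
by apply/frac_eq; ring.
Qed.

Lemma tq_embed_is_monoid_morphism : monoid_morphism tq_embed.
Proof.
by split=> // a b; rewrite [RHS]tq_mulE; apply/frac_eq; rewrite !mulr1.
Qed.

HB.instance Definition _ :=
  GRing.isZmodMorphism.Build A K tq_embed tq_embed_is_zmod_morphism.
HB.instance Definition _ :=
  GRing.isMonoidMorphism.Build A K tq_embed tq_embed_is_monoid_morphism.

Lemma tq_embed_inj : injective tq_embed.
Proof. by move=> a b /frac_eq; rewrite !mulr1. Qed.

Lemma tq_embed_regular s : regular s -> exists x : K, tq_embed s * x = 1.
Proof.
by move=> rs; exists (frac 1 rs); rewrite [LHS]tq_mulE; apply/frac_eq;
   rewrite !mulr1 !mul1r.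
Qed.

Lemma tq_fraction (x : K) :
  exists a s, regular s /\ x * tq_embed s = tq_embed a.
Proof.
have [a [s [rs ->]]] := fracP x; exists a, s; split=> //.
by rewrite [LHS]tq_mulE; apply/frac_eq; rewrite !mulr1.
Qed.

End TotalQuotientRing.

(** * Overrings *)

(* A subring of the total quotient ring containing the image of A. *)
Record overring (A : comPzRingType) := Overring {
  overring_pred : subringClosed (total_quotient A);
  overring_sub : forall a : A, tq_embed a \in overring_pred
}.

Definition overring_sort (A : comPzRingType) (B : overring A) : Type :=
  {x : total_quotient A | x \in overring_pred B}.
Coercion overring_sort : overring >-> Sortclass.

Section OverringStructure.
Variables (A : comPzRingType) (B : overring A).

HB.instance Definition _ := SubChoice.on (overring_sort B).
HB.instance Definition _ := GRing.SubChoice_isSubComPzRing.Build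
  (total_quotient A) _ (overring_sort B) (subringClosedP (overring_pred B)).

Definition overring_embed (a : A) : B := exist _ (tq_embed a) (overring_sub B a).

Lemma overring_embed_is_zmod_morphism : zmod_morphism overring_embed.
Proof. by move=> a b; apply: val_inj; rewrite /= rmorphB. Qed.

Lemma overring_embed_is_monoid_morphism : monoid_morphism overring_embed.
Proof.
by split=> [|a b]; apply: val_inj; rewrite /= ?rmorph1 ?rmorphM.
Qed.

HB.instance Definition _ :=
  GRing.isZmodMorphism.Build A B overring_embed overring_embed_is_zmod_morphism.
HB.instance Definition _ :=
  GRing.isMonoidMorphism.Build A B overring_embed
    overring_embed_is_monoid_morphism.

Definition overring_scale (a : A) (x : B) : B := overring_embed a * x.

Lemma overring_scaleA a b x :
  overring_scale a (overring_scale b x) = overring_scale (a * b) x.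
Proof. by rewrite /overring_scale rmorphM mulrA. Qed.

Lemma overring_scale1 : left_id 1 overring_scale.
Proof. by move=> x; rewrite /overring_scale rmorph1 mul1r. Qed.

Lemma overring_scaleDr : right_distributive overring_scale +%R.
Proof. by move=> a x y; rewrite /overring_scale mulrDr. Qed.

Lemma overring_scaleDl x : {morph overring_scale^~ x : a b / a + b}.
Proof. by move=> a b; rewrite /overring_scale rmorphD mulrDl. Qed.

HB.instance Definition _ := GRing.Zmodule_isLmodule.Build A (overring_sort B)
  overring_scaleA overring_scale1 overring_scaleDr overring_scaleDl.

End OverringStructure.

(** * Going down *)

Definition prime_ideal (A : comPzRingType) (P : set A) : Prop :=
  [/\ P 0, forall x y, P x -> P y -> P (x + y), forall a x, P x -> P (a * x),
      ~ P 1 & forall x y, P (x * y) -> P x \/ P y].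

(* Stated for a ring map f; Q \cap A is the preimage of Q. *)
Definition going_down (A B : comPzRingType) (f : {rmorphism A -> B}) : Prop :=
  forall (P1 P2 : set A) (Q2 : set B),
    prime_ideal P1 -> prime_ideal P2 -> P1 `<=` P2 ->
    prime_ideal Q2 -> f @^-1` Q2 = P2 ->
  exists Q1 : set B, [/\ prime_ideal Q1, Q1 `<=` Q2 & f @^-1` Q1 = P1].

(** * Tensor products and flatness *)

Section Tensor.
Variables (A : comPzRingType) (M E : lmodType A).

Local Notation free := {freeg (M * E)%type / int}.
Local Notation gen m e := (<< (m, e) >> : free).

Definition bilinear_relator (r : free) : Prop :=
  [\/ exists m m' e, r = gen (m + m') e - (gen m e + gen m' e),
      exists m e e', r = gen m (e + e') - (gen m e + gen m e') |
      exists a m e, r = gen (a *: m) e - gen m (a *: e)].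

Definition relations : {pred free} := fun x =>
  `[< forall S : zmodClosed free, (forall r, bilinear_relator r -> r \in S) ->
        x \in S >].

Lemma relations_zmod_closed : zmod_closed relations.
Proof.
split=> [|x y /asboolP xR /asboolP yR]; apply/asboolP => S hS.
  exact: rpred0.
by apply: rpredB; [apply: xR | apply: yR].
Qed.
HB.instance Definition _ :=
  GRing.isZmodClosed.Build free relations relations_zmod_closed.

(* M \otimes_A E as an abelian group: the free abelian group on M * E modulo
   the subgroup generated by the relators. *)
Definition tensor := Quotient.quot relations.
HB.instance Definition _ := GRing.Zmodule.on tensor.

Definition tens (m : M) (e : E) : tensor := \pi_tensor (gen m e).

Definition free_lift (V : zmodType) (f : M -> E -> V) (x : free) : V :=
  fglift (fun p : M * E => f p.1 p.2 : zmodule V) x.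

Lemma free_lift_gen V f m e : @free_lift V f (gen m e) = f m e.
Proof. by rewrite /free_lift liftU scale1r. Qed.

Lemma free_lift_is_zmod_morphism V f : zmod_morphism (@free_lift V f).
Proof. exact: (@lift_is_additive _ _ (zmodule V)). Qed.
HB.instance Definition _ V f :=
  GRing.isZmodMorphism.Build free V (@free_lift V f)
    (@free_lift_is_zmod_morphism V f).

(* The map m \otimes e |-> f m e; it does not depend on the choice of
   representative when f is balanced, see [tensor_lift_pi] below. *)
Definition tensor_lift (V : zmodType) (f : M -> E -> V) (x : tensor) : V :=
  free_lift f (repr x).

Definition balanced (V : zmodType) (f : M -> E -> V) : Prop :=
  [/\ forall m m' e, f (m + m') e = f m e + f m' e,
      forall m e e', f m (e + e') = f m e + f m e' &
      forall a m e, f (a *: m) e = f m (a *: e)].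

Lemma pi_eq_relations (x y : free) :
  x - y \in relations -> \pi_tensor x = \pi_tensor y.
Proof. by move=> h; apply/eqP; rewrite -Quotient.idealrBE. Qed.

Lemma relator_relations r : bilinear_relator r -> r \in relations.
Proof. by move=> hr; apply/asboolP => S; apply. Qed.

Lemma tens_balanced : balanced tens.
Proof.
split=> [m m' e|m e e'|a m e].
- rewrite /tens -[RHS]raddfD; apply/pi_eq_relations/relator_relations.
  by apply: Or31; exists m, m', e.
- rewrite /tens -[RHS]raddfD; apply/pi_eq_relations/relator_relations.
  by apply: Or32; exists m, e, e'.
- by apply/pi_eq_relations/relator_relations/Or33; exists a, m, e.
Qed.

Lemma tensor_sum (x : tensor) :
  exists s : seq (M * E), x = \sum_(p <- s) tens p.1 p.2.
Proof.
have tensN m e : tens (- m) e = - tens m e.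
  have [tD _ _] := tens_balanced.
  have t0 : tens 0 e = 0 by apply: (addrI (tens 0 e)); rewrite -tD !addr0.
  by apply/eqP; rewrite -addr_eq0 -tD addNr t0.
elim/quotW: x; elim/freeg_ind_dom0 => [|k [m e] x _ _ [s Es]].
  by exists [::]; rewrite big_nil raddf0.
have [s' Es'] : exists s' : seq (M * E),
    \pi_tensor << k *g (m, e) >> = \sum_(p <- s') tens p.1 p.2.
  have Ek : << k *g (m, e) >> = gen m e *~ k.
    by rewrite freeg_mulz intz.
  rewrite Ek raddfMz -/(tens m e); case: k {Ek} => n.
    by exists (nseq n (m, e)); rewrite -pmulrn big_nseq iter_addr_0.
  exists (nseq n.+1 (- m, e)); rewrite NegzE -nmulrn big_nseq iter_addr_0.
  by rewrite tensN mulNrn.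
by exists (s' ++ s); rewrite raddfD big_cat; congr (_ + _).
Qed.

Section Lift.
Variables (V : zmodType) (f : M -> E -> V).
Hypothesis bf : balanced f.

Local Notation flift := (free_lift f).

Definition lift_ker : {pred free} := fun x => flift x == 0.

Lemma lift_ker_zmod_closed : zmod_closed lift_ker.
Proof.
split=> [|x y /eqP x0 /eqP y0]; rewrite unfold_in /lift_ker ?raddf0 //.
by rewrite raddfB /= x0 y0 subr0.
Qed.
HB.instance Definition _ :=
  GRing.isZmodClosed.Build free lift_ker lift_ker_zmod_closed.

Lemma free_lift_relations (x : free) : x \in relations -> flift x = 0.
Proof.
move=> /asboolP /(_ lift_ker) h; apply/eqP/h => r.
have [fDl fDr fZ] := bf.
rewrite unfold_in /lift_ker => -[[m [m' [e ->]]]|[m [e [e' ->]]]|[a [m [e ->]]]].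
all: rewrite ?raddfB ?raddfD /= !free_lift_gen ?fDl ?fDr ?fZ -?opprD.
all: by rewrite subrr.
Qed.

Lemma tensor_lift_pi (x : free) : tensor_lift f (\pi_tensor x) = flift x.
Proof.
apply/eqP; rewrite -subr_eq0; apply/eqP.
rewrite /tensor_lift -raddfB.
by apply: free_lift_relations; rewrite Quotient.idealrBE reprK.
Qed.

Lemma tensor_lift_tens m e : tensor_lift f (tens m e) = f m e.
Proof. by rewrite tensor_lift_pi free_lift_gen. Qed.

Lemma tensor_lift_is_zmod_morphism : zmod_morphism (tensor_lift f).
Proof.
elim/quotW=> x; elim/quotW=> y.
by rewrite -[_ - _]raddfB !tensor_lift_pi raddfB.
Qed.

End Lift.

End Tensor.

Definition tensor_map (A : comPzRingType) (E M N : lmodType A)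
    (u : {linear M -> N}) : tensor M E -> tensor N E :=
  tensor_lift (fun m e => tens (u m) e).

Section TensorMap.
Variables (A : comPzRingType) (E M N : lmodType A) (u : {linear M -> N}).

Lemma tensor_map_balanced : balanced (fun m e => tens (u m) e : tensor N E).
Proof.
have [tDl tDr tZ] := @tens_balanced A N E.
by split=> [m m' e|m e e'|a m e]; rewrite ?linearD ?linearZ /= ?tDl ?tDr ?tZ.
Qed.

Lemma tensor_map_tens m e : tensor_map u (tens m e) = tens (u m) e :> tensor N E.
Proof. exact: tensor_lift_tens tensor_map_balanced _ _. Qed.

Lemma tensor_map_is_zmod_morphism : zmod_morphism (@tensor_map A E M N u).
Proof. exact: tensor_lift_is_zmod_morphism tensor_map_balanced. Qed.

End TensorMap.

(* E is flat when - \otimes_A E preserves injections; only the underlying group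
   homomorphism matters for injectivity. *)
Definition flat (A : comPzRingType) (E : lmodType A) : Prop :=
  forall (M N : lmodType A) (u : {linear M -> N}),
    injective u -> injective (@tensor_map A E M N u).

(** * Perinormal rings *)

Definition GD_overring (A : comPzRingType) (B : overring A) : Prop :=
  going_down (@overring_embed A B).

Definition perinormal (A : comPzRingType) : Prop :=
  forall B : overring A, GD_overring B -> @flat A B.

(* Main.v *)
(* Going down and flatness can both be tested on the two components of a product.
   If [C] is a GD-overring of [A], then [C * B] is a GD-overring of [A * B], hence
   flat, and so is its component [C]. Conversely an overring [C] of [A * B] is the
   product of an overring of [A] and one of [B]; if [C] is a GD-overring, so are
   these, and the kernel of [M \otimes C -> N \otimes C] vanishes on each of the
   two components of [M \otimes C]. *)
From Pilot Require Import Defs.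
From HB Require Import structures.
From mathcomp Require Import all_boot all_algebra.
From mathcomp Require Import ring boolp classical_sets.

Set Implicit Arguments.
Unset Strict Implicit.
Unset Printing Implicit Defensive.

Import Pilot.Defs GRing.Theory.
Local Open Scope ring_scope.
Local Open Scope classical_set_scope.

(** * Direct factors of a ring *)

(* [A] is the factor [e R] of [R = e R * (1 - e) R], where [e = factor_in 1];
   [factor_in] is the section [a |-> (a, 0)]. *)
Record factor (R A : comPzRingType) := Factor {
  factor_pr : {rmorphism R -> A};
  factor_in : A -> R;
  factor_inK : cancel factor_in factor_pr;
  factor_prK : forall r, factor_in (factor_pr r) = factor_in 1 * r
}.

Section FactorTheory.
Variables (R A : comPzRingType) (F : factor R A).
Local Notation pr := (factor_pr F).
Local Notation inj := (factor_in F).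
Local Notation e := (factor_in F 1).

Lemma factor_mul1 a : e * inj a = inj a.
Proof. by rewrite -factor_prK factor_inK. Qed.

(** Multiplicativity is not a field of [factor]: it follows by writing [a] and [b] as projections of
    [inj a] and [inj b], because [inj] after [pr] is multiplication by [e]. Additivity below has the
    same source. *)
Lemma factor_inM a b : inj (a * b) = inj a * inj b.
Proof.
rewrite -{1}[a](factor_inK F) -{1}[b](factor_inK F) -rmorphM factor_prK.
by rewrite mulrA factor_mul1.
Qed.

Lemma factor_in_is_zmod_morphism : zmod_morphism inj.
Proof.
move=> a b; rewrite -{1}[a](factor_inK F) -{1}[b](factor_inK F) -rmorphB.
by rewrite factor_prK mulrBr !factor_mul1.
Qed.
HB.instance Definition _ :=
  GRing.isZmodMorphism.Build A R inj factor_in_is_zmod_morphism.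

Lemma factor_idem : e * e = e. Proof. exact: factor_mul1. Qed.

Lemma factor_compl_in a : (1 - e) * inj a = 0.
Proof. by rewrite mulrBl mul1r factor_mul1 subrr. Qed.

Lemma factor_pr_compl : pr (1 - e) = 0.
Proof. by rewrite rmorphB rmorph1 factor_inK subrr. Qed.

Lemma factor_in_eq0 a : inj a = 0 -> a = 0.
Proof. by move=> h; rewrite -[a](factor_inK F) h rmorph0. Qed.

(** Since [inj] sends 1 to [e], the preimage is a proper ideal only when [Q] misses [e]; the other
    prime axioms pull back along the non-unital map [inj]. *)
Lemma prime_factor_in (Q : set R) :
  prime_ideal Q -> ~ Q e -> prime_ideal (inj @^-1` Q).
Proof.
case=> Q0 QD QM Q1 Qp Qe; split=> //=.
- by rewrite raddf0.
- by move=> x y Qx Qy; rewrite raddfD; apply: QD.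
- by move=> a x Qx; rewrite factor_inM; apply: QM.
- by move=> x y; rewrite factor_inM => /Qp.
Qed.

End FactorTheory.

Lemma prime_preimage (R S : comPzRingType) (f : {rmorphism R -> S}) (Q : set S) :
  prime_ideal Q -> prime_ideal (f @^-1` Q).
Proof.
case=> Q0 QD QM Q1 Qp; split; rewrite /preimage/=.
- by rewrite rmorph0.
- by move=> x y Qx Qy; rewrite rmorphD; apply: QD.
- by move=> a x Qx; rewrite rmorphM; apply: QM.
- by rewrite rmorph1.
- by move=> x y; rewrite rmorphM => /Qp.
Qed.

(** * Going down and direct factors *)

Section GoingDown.
Variables (R A S C : comPzRingType) (F : factor R A) (G : factor S C).
Variables (f : {rmorphism R -> S}) (g : {rmorphism A -> C}).
Hypothesis prE : forall r, factor_pr G (f r) = g (factor_pr F r).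
Hypothesis inE : forall a, factor_in G (g a) = f (factor_in F a).

Let e_in : f (factor_in F 1) = factor_in G 1.
Proof. by rewrite -inE rmorph1. Qed.

(** The data are pulled back along the projections, going down is used there, and the prime obtained
    returns to [C] along the section. *)
Lemma going_down_factor : going_down f -> going_down g.
Proof.
move=> gd P1 P2 Q2 pP1 pP2 sP pQ2 cQ2.
have [] := gd (factor_pr F @^-1` P1) (factor_pr F @^-1` P2)
              (factor_pr G @^-1` Q2).
- exact: prime_preimage.
- exact: prime_preimage.
- by move=> r; apply: sP.
- exact: prime_preimage.
- by rewrite -cQ2; apply/seteqP; split=> r /=; rewrite prE.
move=> Q1 [pQ1 sQ cQ1]; have Q1f r : Q1 (f r) <-> P1 (factor_pr F r).
  by rewrite -[P1 _]/((factor_pr F @^-1` P1) r) -cQ1.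
exists (factor_in G @^-1` Q1); split.
(* [Q1] misses the idempotent of [S]: otherwise [P1] would contain the projection of
   [factor_in F 1], which is 1. *)
- apply: prime_factor_in => //; rewrite -e_in => /Q1f.
  by rewrite factor_inK; case: pP1.
- by move=> x /sQ; rewrite /= factor_inK.
- apply/seteqP; split=> a; rewrite /= inE; first by move/Q1f; rewrite factor_inK.
  by move=> h; apply/Q1f; rewrite factor_inK.
Qed.

(* The second hypothesis says that the complementary factors of [R] and [S]
   agree. *)
Lemma going_down_of_factor :
    injective f ->
    (forall z, exists r, (1 - factor_in G 1) * z = (1 - factor_in G 1) * f r) ->
  going_down g -> going_down f.
Proof.
move=> f_inj; rewrite -e_in; set e := factor_in F 1 => compl gd.
move=> P1 P2 Q2 pP1 pP2 sP pQ2 cQ2.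
have Q2f r : Q2 (f r) <-> P2 r by rewrite -cQ2.
have fcE : 1 - f e = f (1 - e) by rewrite rmorphB rmorph1.
have [P10 P1D P1M P11 P1p] := pP1; have [P20 P2D P2M P21 P2p] := pP2.
have [Q20 Q2D Q2M Q21 Q2p] := pQ2.
have e_c : e * (1 - e) = 0 by rewrite mulrBr mulr1 /e factor_idem subrr.
(* The prime [P1] comes from one of the two factors of [R]. If it contains [e], it lives on the
   complementary factor, where [R] and [S] agree; [P2] contains [e] too and hence misses [1 - e]. *)
have [P1e | P1c] : P1 e \/ P1 (1 - e) by apply: P1p; rewrite e_c.
  have nP2c : ~ P2 (1 - e).
    by move=> h; apply: P21; rewrite -(subrK e 1); apply: P2D => //; apply: sP.
  have P1cM r : P1 ((1 - e) * r) -> P1 r by case/P1p => // /sP.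
  (* This is [P1] transported to [S]: the condition bears on the complementary component of [z]
     only. Injectivity of [f] brings equations back to [R], where the factor [1 - e] can be
     cancelled modulo [P1]. *)
  exists [set z | exists2 r, P1 r & (1 - f e) * z = (1 - f e) * f r].
  split; [split|..].
  - by exists 0; rewrite ?rmorph0.
  - move=> x y [r Pr xr] [s Ps ys]; exists (r + s); first exact: P1D.
    by rewrite rmorphD !mulrDr xr ys.
  - move=> z x [r Pr xr]; have [s zs] := compl z.
    exists (s * r); first exact: P1M.
    rewrite mulrA zs -mulrA mulrCA xr rmorphM; ring.
  - case=> r Pr; rewrite mulr1 fcE -rmorphM => /f_inj ce.
    by apply: nP2c; rewrite ce; apply: sP; apply: P1M.
  - move=> x y [t Pt xyt]; have [r xr] := compl x; have [s ys] := compl y.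
    have : P1 ((1 - e) * (r * s)).
      suff -> : (1 - e) * (r * s) = (1 - e) * t by apply: P1M.
      apply: f_inj; rewrite 3!rmorphM -fcE -xyt mulrA -xr -mulrA mulrCA -ys.
      by rewrite mulrCA.
    by move=> /P1cM/P1p [Pr|Ps]; [left; exists r|right; exists s].
  - move=> z [r /sP/Q2f Qr zr]; have : Q2 ((1 - f e) * z).
      by rewrite zr; apply: Q2M.
    by case/Q2p => //; rewrite fcE => /Q2f/nP2c.
  - apply/seteqP; split=> [r [s Ps]|r Pr]; last by exists r.
    rewrite fcE -!rmorphM => /f_inj rs; apply: P1cM; rewrite rs; exact: P1M.
(* In the remaining case [P1] and [P2] contain [1 - e] and miss [e], so both are pulled back from
   primes of [A], and going down for [g] applies. *)
have nP2e : ~ P2 e.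
  by move=> h; apply: P21; rewrite -(subrK e 1); apply: P2D => //; apply: sP.
have Q2c : Q2 (1 - f e) by rewrite fcE; apply/Q2f/sP.
have P1E r : P1 r <-> P1 (e * r).
  split=> [|h]; first exact: P1M.
  rewrite -[r]mul1r -(subrK e 1) mulrDl; apply: P1D => //.
  by rewrite mulrC; apply: P1M.
have Q2E z : Q2 (f e * z) -> Q2 z by case/Q2p => // /Q2f/nP2e.
have [] := gd (factor_in F @^-1` P1) (factor_in F @^-1` P2)
              (factor_in G @^-1` Q2).
- by apply: prime_factor_in => // /sP.
- exact: prime_factor_in.
- by move=> a; apply: sP.
- by apply: prime_factor_in => //; rewrite -e_in => /Q2f/nP2e.
- by rewrite -cQ2; apply/seteqP; split=> a /=; rewrite inE.
move=> Q1 [pQ1 sQ cQ1]; exists (factor_pr G @^-1` Q1); split.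
- exact: prime_preimage.
- by move=> z /sQ /=; rewrite factor_prK -e_in => /Q2E.
- have Q1g a : Q1 (g a) <-> P1 (factor_in F a).
    by rewrite -[P1 _]/((factor_in F @^-1` P1) a) -cQ1.
  apply/seteqP; split=> r /=; rewrite prE.
    by move=> /Q1g; rewrite factor_prK => h; apply/P1E.
  by move=> /P1E h; apply/Q1g; rewrite factor_prK.
Qed.

End GoingDown.

(** * Flatness and direct factors *)

HB.instance Definition _ (A : comPzRingType) (E M N : lmodType A)
    (u : {linear M -> N}) :=
  GRing.isZmodMorphism.Build (tensor M E) (tensor N E) (@tensor_map A E M N u)
    (@tensor_map_is_zmod_morphism A E M N u).

(** The universal property with the map bundled as additive, so that maps out of a tensor product
    can be composed and compared on pure tensors by [tensor_ext]. *)
Lemma tensor_hom (A : comPzRingType) (M E : lmodType A) (V : zmodType)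
    (f : M -> E -> V) :
  balanced f ->
  exists phi : {additive tensor M E -> V}, forall m x, phi (tens m x) = f m x.
Proof.
move=> bf.
pose phi : {additive _ -> _} := HB.pack (tensor_lift f)
  (GRing.isZmodMorphism.Build _ _ _ (tensor_lift_is_zmod_morphism bf)).
by exists phi => m x; apply: tensor_lift_tens.
Qed.

Lemma tensor_ext (A : comPzRingType) (M E : lmodType A) (V : zmodType)
    (phi psi : {additive tensor M E -> V}) :
  (forall m x, phi (tens m x) = psi (tens m x)) -> phi =1 psi.
Proof.
move=> h t; have [s ->] := tensor_sum t.
by rewrite !raddf_sum; apply: eq_bigr.
Qed.

(** A type alias mentioning [f], so that the [R]-module structure attached to it does not compete
    with the [A]-module structure of [M]. *)
Definition restriction (R A : comPzRingType) (f : {rmorphism R -> A})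
  (M : lmodType A) : Type := M.

Section RestrictionOfScalars.
Variables (R A : comPzRingType) (f : {rmorphism R -> A}).
Local Notation restriction := (restriction f).

Section Module.
Variable M : lmodType A.
HB.instance Definition _ := GRing.Zmodule.on (restriction M).

Definition restriction_scale (r : R) (m : restriction M) : restriction M :=
  f r *: (m : M).

Lemma restriction_scaleA a b m :
  restriction_scale a (restriction_scale b m) = restriction_scale (a * b) m.
Proof. by rewrite /restriction_scale rmorphM scalerA. Qed.

Lemma restriction_scale1 : left_id 1 restriction_scale.
Proof. by move=> m; rewrite /restriction_scale rmorph1 scale1r. Qed.

Lemma restriction_scaleDr : right_distributive restriction_scale +%R.
Proof. by move=> a x y; apply: scalerDr. Qed.

Lemma restriction_scaleDl m : {morph restriction_scale^~ m : a b / a + b}.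
Proof. by move=> a b; rewrite /restriction_scale rmorphD; apply: scalerDl. Qed.

HB.instance Definition _ := GRing.Zmodule_isLmodule.Build R (restriction M)
  restriction_scaleA restriction_scale1 restriction_scaleDr restriction_scaleDl.
End Module.

Definition restriction_map (M N : lmodType A) (u : {linear M -> N}) :
  restriction M -> restriction N := u.

Lemma restriction_map_is_linear M N u : linear (@restriction_map M N u).
Proof. by move=> a x y; apply: linearP. Qed.
HB.instance Definition _ M N u := GRing.isLinear.Build R (restriction M)
  (restriction N) _ (@restriction_map M N u) (@restriction_map_is_linear M N u).

End RestrictionOfScalars.
Arguments restriction_map {R A} f {M N} u.

(** * The component [e M] of an [R]-module, as an [A]-module *)

Section Component.
Variables (R A : comPzRingType) (F : factor R A).
Local Notation e := (factor_in F 1).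

Section Module.
Variable M : lmodType R.

(** As [e] is idempotent, its fixed points are exactly the elements of [e M]. *)
Definition component_pred : {pred M} := fun m => e *: m == m.

Lemma component_pred_zmod_closed : zmod_closed component_pred.
Proof.
split=> [|x y /eqP ex /eqP ey]; rewrite unfold_in /component_pred.
  by rewrite scaler0.
by rewrite scalerBr ex ey.
Qed.
HB.instance Definition _ :=
  GRing.isZmodClosed.Build M component_pred component_pred_zmod_closed.

Record component :=
  Component { component_val :> M; _ : component_val \in component_pred }.
HB.instance Definition _ := [isSub for component_val].
HB.instance Definition _ := [Choice of component by <:].
HB.instance Definition _ := [SubChoice_isSubZmodule of component by <:].

Lemma component_scaleP a (m : M) : factor_in F a *: m \in component_pred.
Proof. by rewrite unfold_in /component_pred scalerA factor_mul1. Qed.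

Definition component_scale (a : A) (m : component) : component :=
  Component (component_scaleP a m).

Lemma component_scaleA a b m :
  component_scale a (component_scale b m) = component_scale (a * b) m.
Proof. by apply: val_inj; rewrite /= scalerA factor_inM. Qed.

Lemma component_scale1 : left_id 1 component_scale.
Proof. by move=> [m em]; apply: val_inj; apply/eqP. Qed.

Lemma component_scaleDr : right_distributive component_scale +%R.
Proof. by move=> a x y; apply: val_inj; rewrite /= scalerDr. Qed.

Lemma component_scaleDl m : {morph component_scale^~ m : a b / a + b}.
Proof. by move=> a b; apply: val_inj; rewrite /= raddfD scalerDl. Qed.

HB.instance Definition _ := GRing.Zmodule_isLmodule.Build A component
  component_scaleA component_scale1 component_scaleDr component_scaleDl.

Definition component_pr (m : M) : component := Component (component_scaleP 1 m).

Lemma component_prD : {morph component_pr : x y / x + y}.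
Proof. by move=> x y; apply: val_inj; rewrite /= scalerDr. Qed.

Lemma component_prZ r m : component_pr (r *: m) = factor_pr F r *: component_pr m.
Proof.
by apply: val_inj; rewrite /= !scalerA factor_prK mulrAC factor_idem.
Qed.

(** On [e M] the scalars [r] and [e * r] act alike, so the action of [R] factors through the
    projection to [A]. *)
Lemma component_scaleE r (m : component) :
  val (factor_pr F r *: m) = r *: val m.
Proof.
case: m => m /eqP em /=.
by rewrite factor_prK mulrC -scalerA em.
Qed.
End Module.

Section Map.
Variables (M N : lmodType R) (u : {linear M -> N}).

Lemma component_mapP (m : component M) : u (val m) \in @component_pred N.
Proof.
by case: m => m /= /eqP em; rewrite unfold_in /component_pred -linearZ em.
Qed.

Definition component_map (m : component M) : component N :=
  Component (component_mapP m).

Lemma component_map_is_linear : linear component_map.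
Proof. by move=> a x y; apply: val_inj; rewrite /= linearP. Qed.
HB.instance Definition _ := GRing.isLinear.Build A (component M) (component N) _
  component_map component_map_is_linear.

Lemma component_map_inj : injective u -> injective component_map.
Proof. by move=> u_inj x y [] /u_inj /val_inj. Qed.

Lemma component_map_pr m : component_map (component_pr m) = component_pr (u m).
Proof. by apply: val_inj; rewrite /= linearZ. Qed.
End Map.

End Component.
Arguments component_map {R A} F {M N} u.
Arguments component_pr {R A} F {M} m.

Section Flatness.
Variables (R A : comPzRingType) (F : factor R A).
Variables (D : lmodType R) (E : lmodType A).
Variables (p : {additive D -> E}) (i : {additive E -> D}).
Hypothesis pZ : forall r x, p (r *: x) = factor_pr F r *: p x.
Hypothesis iZ : forall a y, i (a *: y) = factor_in F a *: i y.

(* [M \otimes_A E] is a natural retract of [M \otimes_R D]. *)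
Lemma flat_factor : cancel i p -> flat D -> flat E.
Proof.
move=> iK flD M N u u_inj; apply: raddf_inj => t ut.
pose f := factor_pr F.
pose u' : {linear restriction f M -> restriction f N} := restriction_map f u.
have balI (L : lmodType A) :
    balanced (fun m (y : E) => @tens R (restriction f L) D m (i y)).
  have [tDl tDr tZ] := @tens_balanced R (restriction f L) D.
  split=> [m m' y|m y y'|a m y]; rewrite ?raddfD ?tDl ?tDr //.
  (* Scaling by [a] in [L] is scaling by [factor_in F a] in its restriction, since [a] is the
     projection of that element. *)
  by rewrite iZ -tZ; congr tens; rewrite -{1}[a](factor_inK F).
have [phi phiE] := tensor_hom (balI M); have [phi' phi'E] := tensor_hom (balI N).
have [|psi psiE] := @tensor_hom R (restriction f M) D (tensor M E)
    (fun m (x : D) => @tens A M E m (p x)).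
  have [tDl tDr tZ] := @tens_balanced A M E.
  split=> [m m' x|m x x'|a m x]; rewrite ?raddfD ?tDl ?tDr //.
  by rewrite pZ -tZ.
have nat : phi' \o @tensor_map _ _ _ _ u =1 @tensor_map R D _ _ u' \o phi.
  by apply: tensor_ext => m y; rewrite /= tensor_map_tens phiE phi'E tensor_map_tens.
have retr : psi \o phi =1 idfun.
  by apply: tensor_ext => m y; rewrite /= phiE psiE iK.
rewrite -[t]retr /=; suff -> : phi t = 0 by rewrite raddf0.
apply: (flD _ _ u' u_inj); rewrite raddf0.
by rewrite -[LHS]nat /= ut raddf0.
Qed.

(** Multiplication by [e] on [M \otimes_R D] factors through [e M \otimes_A E], naturally in [M].
    Flatness of [E] makes the map induced by [u] injective on the latter group, so the image of [t]
    there is zero. *)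
Lemma flat_component (M N : lmodType R) (u : {linear M -> N})
    (act : {additive tensor M D -> tensor M D}) t :
    (forall x, i (p x) = factor_in F 1 *: x) ->
    (forall m x, act (tens m x) = tens m (factor_in F 1 *: x)) ->
  flat E -> injective u -> tensor_map u t = 0 -> act t = 0.
Proof.
move=> ipK actE flE u_inj ut.
pose u' : {linear component F M -> component F N} := component_map F u.
have balP (L : lmodType R) :
    balanced (fun m (x : D) => @tens A (component F L) E (component_pr F m) (p x)).
  have [tDl tDr tZ] := @tens_balanced A (component F L) E.
  split=> [m m' x|m x x'|r m x]; rewrite ?component_prD ?raddfD ?tDl ?tDr //.
  by rewrite component_prZ tZ pZ.
have [phi phiE] := tensor_hom (balP M); have [phi' phi'E] := tensor_hom (balP N).
have [tDl tDr tZ] := @tens_balanced R M D.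
have [|psi psiE] := @tensor_hom A (component F M) E (tensor M D)
    (fun m (y : E) => @tens R M D (val m) (i y)).
  split=> [m m' y|m y y'|a m y]; rewrite ?raddfD ?tDl ?tDr //.
  by rewrite iZ -tZ -component_scaleE factor_inK.
have nat : phi' \o @tensor_map _ _ _ _ u =1 @tensor_map A E _ _ u' \o phi.
  apply: tensor_ext => m y.
  by rewrite /= tensor_map_tens phiE phi'E tensor_map_tens -component_map_pr.
(* The composite sends [m \otimes x] to [e m \otimes e x]; moving the left [e] across leaves
   [m \otimes e x]. *)
have retr : psi \o phi =1 act.
  apply: tensor_ext => m x.
  by rewrite /= phiE psiE ipK actE /= tZ scalerA factor_idem.
rewrite -[act t]retr /=; suff -> : phi t = 0 by rewrite raddf0.
apply: (flE _ _ u' (component_map_inj u_inj)).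
by rewrite raddf0 -[LHS]nat /= ut raddf0.
Qed.

End Flatness.

(** * Overrings and direct factors *)

Section TotalQuotientFactor.
Variables (R A : comPzRingType) (F : factor R A).
Local Notation pr := (factor_pr F).
Local Notation inj := (factor_in F).
Local Notation e := (factor_in F 1).

(** If [pr t * a = 0], then [t] already kills [inj a]. *)
Lemma regular_factor_pr t : regular t -> regular (pr t).
Proof.
move=> rt a ta; apply: (@factor_in_eq0 _ _ F); apply: rt.
by rewrite -(factor_mul1 F) mulrCA mulrA -factor_prK -factor_inM ta raddf0.
Qed.

(** In a product this element is [(s, 1)]: the complementary component is filled with 1 because
    [(s, 0)] need not be regular. It serves as the denominator in [tq_in], which maps [a / s] to
    [(a, 0) / (s, 1)]. *)
Lemma regular_factor_in s : regular s -> regular (inj s + (1 - e)).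
Proof.
move=> rs x sx; have ex : e * x = 0.
  rewrite -factor_prK; suff -> : pr x = 0 by rewrite raddf0.
  apply: rs; have <- : pr (inj s + (1 - e)) = s.
    by rewrite rmorphD factor_pr_compl addr0 factor_inK.
  by rewrite -rmorphM sx rmorph0.
by move: sx; rewrite -(factor_mul1 F) mulrDl mulrBl mul1r mulrAC ex mul0r add0r subr0.
Qed.

Definition tq_pr (x : total_quotient R) : total_quotient A :=
  frac (pr (repr x).1) (regular_factor_pr (@den_regular _ (repr x))).

Lemma tq_prE r t (rt : regular t) :
  tq_pr (frac r rt) = frac (pr r) (regular_factor_pr rt).
Proof.
have /frac_eq /= h := frac_repr (frac r rt).
by apply/frac_eq; rewrite -!rmorphM h.
Qed.

Lemma tq_pr_is_zmod_morphism : zmod_morphism tq_pr.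
Proof.
move=> x y; have [a [s [rs ->]]] := fracP x; have [b [t [rt ->]]] := fracP y.
rewrite [- frac b rt]tq_oppE [X in tq_pr X]tq_addE !tq_prE.
rewrite [- frac (pr b) _]tq_oppE [RHS]tq_addE; apply/frac_eq.
by rewrite !(rmorphD, rmorphM, rmorphN).
Qed.

Lemma tq_pr_is_monoid_morphism : monoid_morphism tq_pr.
Proof.
split=> [|x y]; first by rewrite [LHS]tq_prE; apply/frac_eq; rewrite !rmorph1.
have [a [s [rs ->]]] := fracP x; have [b [t [rt ->]]] := fracP y.
rewrite [X in tq_pr X]tq_mulE !tq_prE [RHS]tq_mulE; apply/frac_eq.
by rewrite !rmorphM.
Qed.

HB.instance Definition _ := GRing.isZmodMorphism.Build _ _ tq_pr
  tq_pr_is_zmod_morphism.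
HB.instance Definition _ := GRing.isMonoidMorphism.Build _ _ tq_pr
  tq_pr_is_monoid_morphism.

Definition tq_in (x : total_quotient A) : total_quotient R :=
  frac (inj (repr x).1) (regular_factor_in (@den_regular _ (repr x))).

Lemma tq_inE a s (rs : regular s) :
  tq_in (frac a rs) = frac (inj a) (regular_factor_in rs).
Proof.
have /frac_eq /= h := frac_repr (frac a rs); apply/frac_eq.
(* Numerators [inj b] kill the summand [1 - e] of the denominators, so cross-multiplication reduces
   to the equation in [A]. *)
have c b : inj b * (1 - e) = 0 by rewrite mulrC factor_compl_in.
by rewrite mulrDr c addr0 [RHS]mulrDr c addr0 -!factor_inM h.
Qed.

Lemma tq_inK : cancel tq_in tq_pr.
Proof.
move=> x; have [a [s [rs ->]]] := fracP x; rewrite tq_inE tq_prE; apply/frac_eq.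
by rewrite rmorphD factor_pr_compl addr0 !factor_inK.
Qed.

Lemma tq_in_embed a : tq_in (tq_embed a) = tq_embed (inj a).
Proof. by rewrite tq_inE; apply/frac_eq; rewrite addrC subrK. Qed.

Lemma tq_pr_embed r : tq_pr (tq_embed r) = tq_embed (pr r).
Proof. by rewrite tq_prE; apply/frac_eq; rewrite /= rmorph1. Qed.

Lemma tq_prK x : tq_in (tq_pr x) = tq_in 1 * x.
Proof.
have [r [t [rt ->]]] := fracP x.
rewrite [tq_in 1]tq_in_embed [RHS]tq_mulE tq_prE tq_inE; apply/frac_eq.
rewrite !factor_prK mul1r mulrDr mulrACA factor_idem [e * r * (1 - e)]mulrAC.
by rewrite [e * (1 - e)]mulrC factor_compl_in mul0r addr0 mulrA.
Qed.

(** Total quotient rings thus inherit the decomposition, and the theory of direct factors applies to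
    them with the idempotent [tq_in F 1]. *)
Definition tq_factor : factor (total_quotient R) (total_quotient A) :=
  Factor tq_inK tq_prK.

End TotalQuotientFactor.

(** * Overrings of [R] and [A] matched by the projection and the section *)

Section OverringFactor.
Variables (R A : comPzRingType) (F : factor R A) (C : overring R) (E : overring A).
Hypothesis prP : forall z, z \in overring_pred C -> tq_pr F z \in overring_pred E.
Hypothesis inP : forall x, x \in overring_pred E -> tq_in F x \in overring_pred C.

Definition overring_pr (z : C) : E := exist _ (tq_pr F (val z)) (prP (valP z)).
Definition overring_in (x : E) : C := exist _ (tq_in F (val x)) (inP (valP x)).

Lemma overring_pr_is_zmod_morphism : zmod_morphism overring_pr.
Proof. by move=> x y; apply: val_inj; rewrite /= rmorphB. Qed.

Lemma overring_pr_is_monoid_morphism : monoid_morphism overring_pr.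
Proof. by split=> [|x y]; apply: val_inj; rewrite /= ?rmorph1 ?rmorphM. Qed.

HB.instance Definition _ := GRing.isZmodMorphism.Build _ _ overring_pr
  overring_pr_is_zmod_morphism.
HB.instance Definition _ := GRing.isMonoidMorphism.Build _ _ overring_pr
  overring_pr_is_monoid_morphism.

Lemma overring_inK : cancel overring_in overring_pr.
Proof. by move=> x; apply: val_inj; apply: tq_inK. Qed.

Lemma overring_prK z : overring_in (overring_pr z) = overring_in 1 * z.
Proof. by apply: val_inj; apply: tq_prK. Qed.

Definition overring_factor : factor C E := Factor overring_inK overring_prK.

Lemma overring_factor_prE r :
  factor_pr overring_factor (overring_embed C r) = overring_embed E (factor_pr F r).
Proof. by apply: val_inj; apply: tq_pr_embed. Qed.

Lemma overring_factor_inE a :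
  factor_in overring_factor (overring_embed E a) = overring_embed C (factor_in F a).
Proof. by apply: val_inj; apply: tq_in_embed. Qed.

Lemma overring_factor_in1 :
  factor_in overring_factor 1 = overring_embed C (factor_in F 1).
Proof. by rewrite -overring_factor_inE rmorph1. Qed.

Lemma overring_factor_prZ r (x : C) :
  factor_pr overring_factor (r *: x) =
  factor_pr F r *: (factor_pr overring_factor x : E).
Proof. by rewrite [LHS]rmorphM overring_factor_prE. Qed.

Lemma overring_factor_inZ a (y : E) :
  factor_in overring_factor (a *: y) =
  factor_in F a *: (factor_in overring_factor y : C).
Proof. by rewrite [LHS]factor_inM overring_factor_inE. Qed.

Lemma overring_embed_inj : injective (overring_embed C).
Proof. by move=> r s [] /tq_embed_inj. Qed.

End OverringFactor.

Section ExtendOverring.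
Variables (R A : comPzRingType) (F : factor R A) (E : overring A).
Local Notation c := (1 - tq_in F 1).

(* [E * B] when [R = A * B]. *)
Definition extend_pred : {pred total_quotient R} := fun z =>
  `[< tq_pr F z \in overring_pred E /\ exists r, c * z = c * tq_embed r >].

Lemma extend_pred_subring_closed : subring_closed extend_pred.
Proof.
split.
- apply/asboolP; rewrite rmorph1; split; first exact: rpred1.
  by exists 1; rewrite rmorph1.
- move=> x y /asboolP [Ex [r xr]] /asboolP [Ey [s ys]]; apply/asboolP.
  rewrite rmorphB; split; first exact: rpredB.
  by exists (r - s); rewrite rmorphB !mulrBr xr ys.
- move=> x y /asboolP [Ex [r xr]] /asboolP [Ey [s ys]]; apply/asboolP.
  rewrite rmorphM; split; first exact: rpredM.
  by exists (r * s); rewrite rmorphM mulrA xr -mulrA mulrCA ys mulrCA.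
Qed.
HB.instance Definition _ := GRing.isSubringClosed.Build (total_quotient R)
  extend_pred extend_pred_subring_closed.

Lemma extend_pred_embed r : tq_embed r \in extend_pred.
Proof.
by apply/asboolP; rewrite tq_pr_embed overring_sub; split=> //; exists r.
Qed.

Definition extend_overring : overring R := Overring extend_pred_embed.

Lemma extend_pr z :
  z \in overring_pred extend_overring -> tq_pr F z \in overring_pred E.
Proof. by case/asboolP. Qed.

Lemma extend_in x :
  x \in overring_pred E -> tq_in F x \in overring_pred extend_overring.
Proof.
move=> Ex; apply/asboolP; rewrite tq_inK; split=> //.
(* The complementary component of [tq_in F x] is 0, which gives the witness. *)
exists 0; rewrite rmorph0 mulr0; exact: (factor_compl_in (tq_factor F)).
Qed.

End ExtendOverring.

Section ContractOverring.
Variables (R A : comPzRingType) (F : factor R A) (C : overring R).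

(** The component of [C] in the total quotient ring of [A]. Because [C] contains the idempotent
    [tq_in F 1], this preimage is also the image of [C] under [tq_pr F]. *)
Definition contract_pred : {pred total_quotient A} := fun x =>
  tq_in F x \in overring_pred C.

Lemma contract_pred_subring_closed : subring_closed contract_pred.
Proof.
split=> [|x y Cx Cy|x y Cx Cy]; rewrite unfold_in /contract_pred.
- by rewrite [tq_in F 1]tq_in_embed overring_sub.
- by rewrite [tq_in F _](raddfB (factor_in (tq_factor F))) rpredB.
- by rewrite [tq_in F _](factor_inM (tq_factor F)) rpredM.
Qed.
HB.instance Definition _ := GRing.isSubringClosed.Build (total_quotient A)
  contract_pred contract_pred_subring_closed.

Lemma contract_pred_embed a : tq_embed a \in contract_pred.
Proof. by rewrite unfold_in /contract_pred tq_in_embed overring_sub. Qed.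

Definition contract_overring : overring A := Overring contract_pred_embed.

Lemma contract_pr z :
  z \in overring_pred C -> tq_pr F z \in overring_pred contract_overring.
Proof.
move=> Cz; rewrite unfold_in /= /contract_pred tq_prK rpredM //.
by rewrite [tq_in F 1]tq_in_embed overring_sub.
Qed.

Lemma contract_in x :
  x \in overring_pred contract_overring -> tq_in F x \in overring_pred C.
Proof. by []. Qed.

End ContractOverring.

(** * Perinormality and direct factors *)

Lemma perinormal_factor (R A : comPzRingType) (F : factor R A) :
  perinormal R -> perinormal A.
Proof.
move=> pR E gdE; pose D := extend_overring F E.
pose G := overring_factor (@extend_pr _ _ F E) (@extend_in _ _ F E).
apply: (@flat_factor _ _ F D E (factor_pr G) (factor_in G)).
- exact: overring_factor_prZ.
- exact: overring_factor_inZ.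
- exact: factor_inK.
apply: pR; apply: (@going_down_of_factor _ _ _ _ F G _ _ _ _ _ _ gdE).
- exact: overring_factor_prE.
- exact: overring_factor_inE.
- exact: overring_embed_inj.
(* The second clause of [extend_pred] is precisely the agreement of the complementary factors. *)
- move=> z; have /asboolP[_ [r zr]] := valP z.
  by exists r; apply: val_inj.
Qed.

(** One component of the kernel argument. As [tensor] carries only a group structure, multiplication
    by the idempotent enters as an additive map [act] prescribed on pure tensors. *)
Lemma flat_contract (R A : comPzRingType) (F : factor R A) (C : overring R)
    (M N : lmodType R) (u : {linear M -> N})
    (act : {additive tensor M C -> tensor M C}) t :
    perinormal A -> GD_overring C ->
    (forall m x, act (tens m x) = tens m (factor_in F 1 *: x)) ->
  injective u -> tensor_map u t = 0 -> act t = 0.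
Proof.
move=> pA gdC actE; pose E := contract_overring F C.
pose G := overring_factor (@contract_pr _ _ F C) (@contract_in _ _ F C).
apply: (@flat_component _ _ F C E (factor_pr G) (factor_in G)) => //.
- exact: overring_factor_prZ.
- exact: overring_factor_inZ.
- move=> x; rewrite [LHS]factor_prK; congr (_ * _).
  exact: overring_factor_in1.
apply: pA; apply: (@going_down_factor _ _ _ _ F G _ _ _ _ gdC).
- exact: overring_factor_prE.
- exact: overring_factor_inE.
Qed.

Lemma perinormal_of_factors (R A B : comPzRingType) (F : factor R A)
    (G : factor R B) :
    factor_in F 1 + factor_in G 1 = 1 ->
  perinormal A -> perinormal B -> perinormal R.
Proof.
move=> FG1 pA pB C gdC M N u u_inj; apply: raddf_inj => t ut.
have [tDl tDr tZ] := @tens_balanced R M C.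
have bal a : balanced (fun m (x : C) => @tens R M C m (a *: x)).
  split=> [m m' x|m x x'|b m x]; rewrite ?scalerDr ?tDl ?tDr //.
  by rewrite tZ !scalerA mulrC.
have [f fE] := tensor_hom (bal (factor_in F 1)).
have [g gE] := tensor_hom (bal (factor_in G 1)).
(* The two idempotents sum to 1, so [t] is the sum of its two components, each of which is zero by
   [flat_contract]. *)
have fg : f \+ g =1 idfun.
  by apply: tensor_ext => m x; rewrite /= fE gE -tDr -scalerDl FG1 scale1r.
rewrite -[t]fg /= (flat_contract pA gdC fE u_inj ut).
by rewrite (flat_contract pB gdC gE u_inj ut) addr0.
Qed.

Section Product.
Variables A B : comPzRingType.

Lemma fst_factorK : cancel (fun a : A => (a, 0 : B)) fst.
Proof. by []. Qed.

Lemma fst_factor_prK (r : A * B) : (fst r, 0) = (1, 0) * r.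
Proof. by apply: injective_projections; rewrite /= ?mul1r ?mul0r. Qed.

Definition fst_factor : factor (A * B)%type A :=
  @Factor (A * B)%type A fst _ fst_factorK fst_factor_prK.

Lemma snd_factorK : cancel (fun b : B => (0 : A, b)) snd.
Proof. by []. Qed.

Lemma snd_factor_prK (r : A * B) : (0, snd r) = (0, 1) * r.
Proof. by apply: injective_projections; rewrite /= ?mul1r ?mul0r. Qed.

Definition snd_factor : factor (A * B)%type B :=
  @Factor (A * B)%type B snd _ snd_factorK snd_factor_prK.

End Product.

Theorem theorem11 (A B : comPzRingType) :
  perinormal (A * B)%type <-> perinormal A /\ perinormal B.
Proof.
split=> [pAB|[pA pB]].
  by split; [apply: perinormal_factor (fst_factor A B) pAB
            |apply: perinormal_factor (snd_factor A B) pAB].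
apply: (@perinormal_of_factors _ _ _ (fst_factor A B) (snd_factor A B)) => //.
by apply: injective_projections; rewrite /= ?addr0 ?add0r.
Qed.
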